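(* Let $\mathcal L$ be a countable language with a distinguished unary predicate $X$, and let $\mathbf K$ be a suitable class of countable $\mathcal L$-structures. Then there is a $\mathbf K$-limit $M$ admitting an equivalence relation $E$ on $X^M$ with infinitely many classes such that every permutation $h$ of $X^M/E$ lifts to an automorphism of $M$, i.e. there is $\sigma\in\mathrm{Aut}(M)$ with $\sigma(x)/E=h(x/E)$ for all $x\in X^M$.
   Context: $\mathbf K$ has disjoint amalgamation if whenever $A,B,C\in\mathbf K$ with $A$ a substructure of both $B$ and $C$ and $B\cap C=A$, there is $D\in\mathbf K$ containing both $B$ and $C$ as substructures. $\mathbf K$ is $X$-growing if every $A\in\mathbf K$ has an extension $B\supseteq A$ in $\mathbf K$ with $X^B$ properly extending $X^A$. $\mathbf K$ is suitable if it is closed under isomorphism, has disjoint amalgamation, is $X$-growing, and contains some $A$ with $X^A=\emptyset$. An $\mathcal L$-structure $M$ is a $\mathbf K$-limit if $M=\bigcup_{n\in\omega}A_n$ with each $A_n\in\mathbf K$ and $A_n$ a substructure of $A_m$ whenever $n\le m$. *)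

(* Defs.v *)
From mathcomp Require Import all_boot.
From mathcomp Require Import boolp classical_sets functions cardinality.
From Stdlib Require Import RelationClasses.

Set Implicit Arguments.
Unset Strict Implicit.
Unset Printing Implicit Defensive.

Local Open Scope classical_set_scope.

(* Constants are the function symbols of arity 0. *)
Record language := Language {
  fsym : Type;
  farity : fsym -> nat;
  rsym : Type;
  rarity : rsym -> nat }.

Definition countable_language (L : language) : Prop :=
  countable [set: fsym L] /\ countable [set: rsym L].

(* The carrier may be empty; a class K that excludes the empty structure is
   just a particular case. *)
Record structure (L : language) := Structure {
  carrier :> Type;
  fint : forall s : fsym L, ('I_(farity s) -> carrier) -> carrier;
  rint : forall r : rsym L, ('I_(rarity r) -> carrier) -> Prop }.

Arguments fint {L} s : rename.
Arguments rint {L} s : rename.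

(* X^M, for a symbol X of arity 1: the 1-tuple (x) is the constant map, which
   avoids a cast along [rarity X = 1]. *)
Definition pred_of (L : language) (X : rsym L) (M : structure L) : set M :=
  [set x | rint M X (fun=> x)].

Arguments pred_of {L} X M.

Definition embedding (L : language) (M N : structure L) (f : M -> N) : Prop :=
  [/\ injective f,
      forall s (a : 'I_(farity s) -> M), f (fint M s a) = fint N s (f \o a)
    & forall r (a : 'I_(rarity r) -> M), rint M r a <-> rint N r (f \o a)].

Definition isomorphism (L : language) (M N : structure L) (f : M -> N) : Prop :=
  embedding f /\ bijective f.

Definition automorphism (L : language) (M : structure L) (f : M -> M) : Prop :=
  isomorphism f.

Definition closed_subset (L : language) (M : structure L) (S : set M) : Prop :=
  forall s (a : 'I_(farity s) -> M), (forall i, S (a i)) -> S (fint M s a).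

Definition induced_fint (L : language) (M : structure L) (S : set M)
    (cS : closed_subset S) (s : fsym L) (a : 'I_(farity s) -> S) : S :=
  exist _ (fint M s (fun i => val (a i)))
    (mem_set (cS s _ (fun i => set_mem (valP (a i))))).

Definition substructure (L : language) (M : structure L) (S : set M)
    (cS : closed_subset S) : structure L :=
  @Structure L S (@induced_fint L M S cS)
    (fun r a => rint M r (fun i => val (a i))).

Section Classes.
Variables (L : language) (X : rsym L) (K : structure L -> Prop).

Definition iso_closed : Prop :=
  forall (A B : structure L) (f : A -> B), isomorphism f -> K A -> K B.

(* "A is a substructure of B" between distinct carriers is expressed by an
   embedding A -> B. In D, the copies of B and C agree on A and meet exactly in
   the copy of A, which is what B `&` C = A means when the inclusions are
   literal; for an isomorphism-closed K the two formulations coincide. *)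
Definition disjoint_amalgamation : Prop :=
  forall (A B C : structure L) (f : A -> B) (g : A -> C),
    K A -> K B -> K C -> embedding f -> embedding g ->
  exists (D : structure L) (f' : B -> D) (g' : C -> D),
    [/\ K D, embedding f', embedding g', f' \o f = g' \o g
      & range f' `&` range g' = range (f' \o f)].

Definition growing : Prop :=
  forall A : structure L, K A ->
  exists (B : structure L) (f : A -> B),
    [/\ K B, embedding f & f @` pred_of X A `<` pred_of X B].

Definition suitable : Prop :=
  [/\ iso_closed, disjoint_amalgamation, growing
    & exists2 A : structure L, K A & pred_of X A = set0].

(* Every A n carries the structure induced from M, so A n `<=` A m already makes
   A n a substructure of A m. *)
Definition is_limit (M : structure L) : Prop :=
  exists (A : nat -> set M) (cA : forall n, closed_subset (A n)),
    [/\ forall n, K (substructure (cA n)),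
        forall n m, (n <= m)%N -> A n `<=` A m
      & \bigcup_n A n = [set: M]].

End Classes.

(* The class of x under E is the set [E x], so the set of all classes is
   [range E]. *)
Definition quotient (T : Type) (E : T -> set T) : Type := range E.

Definition class_of (T : Type) (E : T -> set T) (x : T) : quotient E :=
  exist _ (E x) (mem_set (imageT E x)).

(* Main.v *)
Require Import Defs.
From mathcomp Require Import all_boot.
From mathcomp Require Import boolp classical_sets functions cardinality.
From Stdlib Require Import RelationClasses.

Set Implicit Arguments.
Unset Strict Implicit.
Unset Printing Implicit Defensive.

Local Open Scope classical_set_scope.

(* M is the union of a chain of structures A_n in K, each X^(A_n) being coloured
   by finitely many natural numbers; E is equality of colours. From A_n one builds
   A_(n+1) by amalgamating disjointly and then growing, the new elements of X
   getting colour n, so that every colour occurs. The amalgamation adds an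
   embedding g_n : A_(i+1) -> A_(n+1), for some i < n, such that g_n (g_i x) = x on
   the domain of g_i and such that g_n acts on colours by a prescribed finite map
   s. Disjointness is what makes the colours of g_n(x) free to choose outside
   g_i(dom g_i). All pairs (i, s) are treated, and one starts from A_0 with X^(A_0)
   empty, so for each permutation h of the colours there is a sequence of the g_i
   that follows h and h^-1 alternately, each extending the inverse of the previous
   one; its union is an automorphism inducing h. *)

(** * Maps and embeddings *)

Lemma inj_surj_bijective (S T : Type) (f : S -> T) :
  injective f -> (forall y, exists x, f x = y) -> bijective f.
Proof.
move=> finj fsurj; have [g gK] := choice fsurj.
by exists g => // x; apply: finj; rewrite gK.
Qed.

(** Used with [i] the inclusion of a subset, to turn a map on the subset into a total one; [d]
    supplies the values outside the range. *)
Lemma factor_inj (S T V : Type) (i : S -> T) (F : S -> V) (d : T -> V) :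
  injective i -> exists g : T -> V, forall x, g (i x) = F x.
Proof.
move=> iinj.
have /choice[g gP] : forall t, exists v, forall x, i x = t -> v = F x.
  move=> t; have [[x ix]|nix] := pselect (exists x, i x = t).
    by exists (F x) => y iy; congr F; apply: iinj; rewrite ix.
  by exists (d t) => x ix; case: nix; exists x.
by exists g => x; exact: gP.
Qed.

Lemma tuple_factor (I S T : Type) (i : S -> T) (b : I -> T) :
  (forall k, exists x, i x = b k) -> exists a, b = i \o a.
Proof.
by move=> /choice[a aP]; exists a; apply/funext => k /=; rewrite aP.
Qed.

Lemma embedding_comp (L : language) (A B C : structure L) (f : A -> B)
    (g : B -> C) : embedding f -> embedding g -> embedding (g \o f).
Proof.
move=> [fi ff fr] [gi gf gr]; split.
- exact: inj_comp.
- by move=> s a /=; rewrite ff gf.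
- by move=> r a; rewrite fr gr.
Qed.

Lemma embedding_pred (L : language) (X : rsym L) (A B : structure L)
    (f : A -> B) x : embedding f -> pred_of X B (f x) <-> pred_of X A x.
Proof. by move=> [_ _ fr]; split=> /fr. Qed.

(* The first component of a point is the stage at which it is created. *)
Definition point : Type := (nat * nat)%type.

(** * Coloured structures on a countable set of points *)

Section Construction.
Variable L : language.

(* A coloured structure on the subset [dom]; [fn], [rl] and [col] are total, and
   their values outside [dom] are junk. *)
Record pstruct := Pstruct {
  dom : set point;
  fn : forall s : Defs.fsym L, ('I_(farity s) -> point) -> point;
  rl : forall r : rsym L, ('I_(rarity r) -> point) -> Prop;
  col : point -> nat }.

Definition str (P : pstruct) : structure L := @Structure L point (fn P) (rl P).

(** In the completed construction this is the domain of the stage [A_i], since points created later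
    have first component above [i]. *)
Definition layer (P : pstruct) (i : nat) : set point :=
  [set u | dom P u /\ u.1 <= i].

(** A partial embedding is kept as a total map whose values outside [S] are ignored, so that a
    history can store it without dependent types. *)
Definition pemb (P : pstruct) (S T : set point) (e : point -> point) : Prop :=
  [/\ forall x, S x -> T (e x),
      forall x y, S x -> S y -> e x = e y -> x = y,
      forall s (a : 'I_(farity s) -> point), (forall i, S (a i)) ->
        e (fn P a) = fn P (e \o a)
    & forall r (a : 'I_(rarity r) -> point), (forall i, S (a i)) ->
        (rl P a <-> rl P (e \o a))].

(** The first clause also forces every point of [Q] outside [P] to have first component above [n],
    so [dom P] is recovered from [Q] as a layer. *)
Definition extends (n : nat) (P Q : pstruct) : Prop :=
  [/\ forall u, dom P u <-> layer Q n u,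
      forall s (a : 'I_(farity s) -> point), (forall i, dom P (a i)) ->
        fn Q a = fn P a,
      forall r (a : 'I_(rarity r) -> point), (forall i, dom P (a i)) ->
        (rl Q a <-> rl P a)
    & forall u, dom P u -> col Q u = col P u].

Lemma layerS P i j : i <= j -> layer P i `<=` layer P j.
Proof. by move=> ij u [Pu ui]; split=> //; exact: leq_trans ij. Qed.

(** * Transport of structure along an injection into points *)

Section Transport.
Variables (D : structure L) (phi : D -> point) (phi_inj : injective phi).

Definition push_fn (s : Defs.fsym L) (b : 'I_(farity s) -> point) : point :=
  if pselect (exists a, b = phi \o a) is left H
  then phi (fint D s (projT1 (cid H))) else (0, 0).

Definition push_rl (r : rsym L) (b : 'I_(rarity r) -> point) : Prop :=
  exists2 a, b = phi \o a & rint D r a.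

Lemma comp_phi_inj (I : Type) (a b : I -> D) : phi \o a = phi \o b -> a = b.
Proof.
by move=> E; apply/funext => i; apply: phi_inj; move/(congr1 (@^~ i)): E.
Qed.

Lemma push_fnE s (a : 'I_(farity s) -> D) :
  push_fn (phi \o a) = phi (fint D s a).
Proof.
rewrite /push_fn; case: pselect => [H|[]]; last by exists a.
by case: cid => b /= /comp_phi_inj ->.
Qed.

Lemma push_rlE r (a : 'I_(rarity r) -> D) :
  push_rl (phi \o a) <-> rint D r a.
Proof. by split=> [[b /comp_phi_inj ->]|Da] //; exists a. Qed.

Definition push (c : point -> nat) : pstruct :=
  Pstruct (range phi) push_fn push_rl c.

End Transport.

Section Class.
Variable K : structure L -> Prop.
Hypothesis isoK : iso_closed K.

Definition Ksub (P : pstruct) (S : set point) : Prop :=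
  exists cS : @closed_subset L (str P) S, K (substructure cS).

Lemma Ksub_push (D : structure L) (phi : D -> point) c :
  injective phi -> K D -> Ksub (push phi c) (range phi).
Proof.
move=> phi_inj KD.
have cS : @closed_subset L (str (push phi c)) (range phi).
  move=> s b /= bP.
  have [a ->] : exists a, b = phi \o a.
    by apply: tuple_factor => k; have [d _ <-] := bP k; exists d.
  by rewrite push_fnE //; exists (fint D s a).
exists cS; pose f (d : D) : substructure cS :=
  exist _ (phi d) (mem_set (imageT phi d)).
apply: (isoK (f := f)) => //; split; last first.
  apply: inj_surj_bijective => [x y [/phi_inj //]|[u up]].
  by have /set_mem[d _ ud] := up; exists d; exact: val_inj.
split=> [x y [/phi_inj //]|s a|r a].
- by apply: val_inj => /=; rewrite -push_fnE.
- by rewrite -(push_rlE phi_inj).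
Qed.

(** Both substructures have carrier [S], and the identity is an isomorphism between them. *)
Lemma Ksub_agree (P Q : pstruct) (S : set point) :
    (forall s (a : 'I_(farity s) -> point), (forall i, S (a i)) ->
      fn Q a = fn P a) ->
    (forall r (a : 'I_(rarity r) -> point), (forall i, S (a i)) ->
      (rl Q a <-> rl P a)) ->
  Ksub P S -> Ksub Q S.
Proof.
move=> eqf eqr [cP KP].
have cQ : @closed_subset L (str Q) S.
  by move=> s a aS /=; rewrite eqf //; exact: (cP s a).
exists cQ; apply: (isoK (f := (fun x => x) : substructure cP -> substructure cQ)) => //.
split; last by exists id.
have vS (I : Type) (a : I -> S) k : S (val (a k)) by exact: set_mem (valP (a k)).
split=> // [s a|r a].
- by apply: val_inj; rewrite /= eqf //; exact: vS.
- by rewrite /= eqr //; exact: vS.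
Qed.

Lemma extends_pemb n P Q S T e : S `<=` dom P -> T `<=` dom P ->
  extends n P Q -> pemb P S T e -> pemb Q S T e.
Proof.
move=> SP TP [_ ef er _] [e1 e2 e3 e4].
have Pa (I : Type) (a : I -> point) : (forall i, S (a i)) ->
  forall i, dom P (a i) by move=> aS i; exact: SP.
have Pea (I : Type) (a : I -> point) : (forall i, S (a i)) ->
  forall i, dom P ((e \o a) i) by move=> aS i; apply: TP; exact: e1.
split=> // [s a aS|r a aS].
- by rewrite (ef s a (Pa _ _ aS)) (ef s _ (Pea _ _ aS)) e3.
- by rewrite (er r a (Pa _ _ aS)) (er r _ (Pea _ _ aS)) e4.
Qed.

(** * One extension step: amalgamation, growth and colouring *)

Hypothesis cK : forall A : structure L, K A -> countable [set: A].
Variable X : rsym L.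
Hypothesis daK : disjoint_amalgamation K.
Hypothesis grK : growing X K.

Definition Xat (P : pstruct) (u : point) : Prop := rl P (fun _ : 'I_(rarity X) => u).

Lemma countable_inj (D : structure L) :
  K D -> exists nu : D -> nat, injective nu.
Proof.
move=> /cK /countable_injP[nu nuI]; exists nu => x y.
by apply: nuI; exact/mem_set.
Qed.

(** Amalgamate [P] with [T] over [S], where [S] is included in [P] and mapped into [T] by [e]. In
    the amalgam [e x] is glued to [x], so the embedding [g] of [T] inverts [e]. Growing then
    provides an element of [X] outside both copies. *)
Lemma extension_step (n : nat) (P : pstruct) (S T : set point)
    (e : point -> point) (p : nat -> nat) :
    dom P `<=` [set u | u.1 <= n] ->
    Ksub P (dom P) -> Ksub P S -> Ksub P T ->
    S `<=` dom P -> T `<=` dom P -> pemb P S T e ->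
    (forall x, S x -> Xat P x -> p (col P (e x)) = col P x) ->
  exists (Q : pstruct) (g : point -> point),
    [/\ extends n P Q, dom Q `<=` [set u | u.1 <= n.+1] & Ksub Q (dom Q)] /\
    [/\ pemb Q T (dom Q) g,
        forall x, S x -> g (e x) = x,
        forall x, T x -> Xat Q x -> col Q (g x) = p (col P x),
        forall u, dom Q u -> dom P u \/ col Q u = n \/
          exists2 x, T x & col Q u = p (col P x)
      & exists u, [/\ dom Q u, Xat Q u & col Q u = n]].
Proof.
move=> domn [cP KP] [cS KS] [cT KT] SP TP [e1 e2 e3 e4] pS.
pose A := substructure cS; pose B := substructure cT; pose C := substructure cP.
pose f (x : A) : B := exist _ (e (val x)) (mem_set (e1 _ (set_mem (valP x)))).
pose i (x : A) : C := exist _ (val x) (mem_set (SP _ (set_mem (valP x)))).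
have vA (I : Type) (a : I -> A) k : S (val (a k)) by exact: set_mem (valP (a k)).
have vB (I : Type) (a : I -> B) k : T (val (a k)) by exact: set_mem (valP (a k)).
have femb : embedding f.
  split=> [x y [/e2 exy]|s a|r a].
  - by apply: val_inj; apply: exy; exact: set_mem (valP _).
  - by apply: val_inj; rewrite /= e3 //; exact: vA.
  - by rewrite /= e4 //; exact: vA.
have iemb : embedding i.
  split=> [x y [/val_inj //]|s a|r a //].
  by apply: val_inj.
have [D0 [f' [g' [KD0 f'emb g'emb comm disj]]]] := daK KS KT KP femb iemb.
have [D [gr [KD gremb grX]]] := grK KD0.
have [nu nuI] := countable_inj KD.
have [grI _ _] := gremb.
have f1emb := embedding_comp f'emb gremb.
have g1emb := embedding_comp g'emb gremb.
have g1I : injective (gr \o g') by case: g1emb.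
(* Elements coming from [P] keep their names; all others are named in stage [n.+1], away from
   [dom P]. *)
have /choice[phi phiP] : forall d : D, exists u : point,
    (forall c, d = gr (g' c) -> u = val c) /\
    ((forall c, d <> gr (g' c)) -> u = (n.+1, nu d)).
  move=> d; have [[c dc]|nc] := pselect (exists c, d = gr (g' c)).
    exists (val c); split=> [c'|/(_ c)] //.
    by rewrite dc => /g1I ->.
  exists (n.+1, nu d); split=> // c dc; first by case: nc; exists c.
have phi_old c : phi (gr (g' c)) = val c by have [h _] := phiP (gr (g' c)); exact: h.
have phi_new d : (forall c, d <> gr (g' c)) -> phi d = (n.+1, nu d).
  by have [_] := phiP d.
have domC (c : C) : dom P (val c) by exact: set_mem (valP c).
have newNdom d : (forall c, d <> gr (g' c)) -> ~ dom P (phi d).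
  by move=> /phi_new -> /domn /=; rewrite ltnn.
have oldE d : dom P (phi d) -> exists c, d = gr (g' c).
  by move=> Pd; apply: contrapT => /forallNP /newNdom; exact.
have phi_inj : injective phi.
  move=> d d' E; have [Pd|nPd] := pselect (dom P (phi d)).
    have [c dc] := oldE d Pd; rewrite E in Pd; have [c' dc'] := oldE d' Pd.
    by rewrite dc dc' in E *; rewrite !phi_old in E; rewrite (val_inj E).
  have nd : forall c, d <> gr (g' c).
    by move=> c dc; apply: nPd; rewrite dc phi_old.
  have nd' : forall c, d' <> gr (g' c).
    by move=> c dc; apply: nPd; rewrite E dc phi_old.
  by move: E; rewrite !phi_new // => -[/nuI].
have [g gE] := factor_inj (fun b : B => phi (gr (f' b))) id (@val_inj _ _ B).
(* Old points keep their colour, new points in the copy of [T] take the colour imposed by [p], and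
   all remaining points get [n]. *)
have /choice[c cP'] : forall u, exists m : nat,
    [/\ dom P u -> m = col P u,
        ~ dom P u -> forall x : B, u = phi (gr (f' x)) -> m = p (col P (val x))
      & ~ dom P u -> (forall x : B, u <> phi (gr (f' x))) -> m = n].
  move=> u; have [Pu|nPu] := pselect (dom P u); first by exists (col P u).
  have [[x ux]|nx] := pselect (exists x : B, u = phi (gr (f' x))).
    exists (p (col P (val x))); split=> // [_ y|_ /(_ x)//].
    have [f'I _ _] := f'emb.
    by rewrite ux => /phi_inj /grI /f'I ->.
  by exists n; split=> // _ x ux; case: nx; exists x.
pose Q := push phi c.
have QfE s (a : 'I_(farity s) -> D) : fn Q (phi \o a) = phi (fint D s a).
  exact: push_fnE.
have QrE r (a : 'I_(rarity r) -> D) : rl Q (phi \o a) <-> rint D r a.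
  exact: push_rlE.
have tupC (I : Type) (a : I -> point) : (forall k, dom P (a k)) ->
    exists a' : I -> C, a = val \o a'.
  by move=> aP; apply: tuple_factor => k; exists (exist _ (a k) (mem_set (aP k))).
have tupB (I : Type) (a : I -> point) : (forall k, T (a k)) ->
    exists a' : I -> B, a = val \o a'.
  by move=> aP; apply: tuple_factor => k; exists (exist _ (a k) (mem_set (aP k))).
have valC (I : Type) (a : I -> C) : val \o a = phi \o ((gr \o g') \o a).
  by apply/funext => k /=; rewrite phi_old.
have PQr r (a : 'I_(rarity r) -> point) : (forall k, dom P (a k)) ->
    (rl Q a <-> rl P a).
  move=> /tupC[a' ->]; rewrite [in rl Q _]valC QrE.
  by case: g1emb => _ _ <-.
have PQf s (a : 'I_(farity s) -> point) : (forall k, dom P (a k)) ->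
    fn Q a = fn P a.
  move=> /tupC[a' ->]; rewrite [in fn Q _]valC QfE.
  by case: g1emb => _ <- _; rewrite phi_old.
have PdomQ u : dom P u -> dom Q u.
  by move=> Pu; exists (gr (g' (exist _ u (mem_set Pu)))); rewrite // phi_old.
have XQ d : Xat Q (phi d) <-> pred_of X D d by exact: (QrE X (fun=> d)).
have colOld u : dom P u -> col Q u = col P u by case: (cP' u).
have gS x : S x -> g (e x) = x.
  move=> Sx; pose a : A := exist _ x (mem_set Sx).
  have -> : e x = val (f a) by [].
  rewrite gE; have -> : f' (f a) = g' (i a) by move/(congr1 (@^~ a)): comm.
  by rewrite phi_old.
exists Q, g; split; split.
- split=> // u; split=> [Pu|[[d _ <-]] /= dn].
    by split; [exact: PdomQ|exact: domn].
  apply: contrapT => nPd; move: dn; rewrite phi_new ?ltnn // => c' dc.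
  by apply: nPd; rewrite dc phi_old.
- move=> u [d _ <-] /=; have [Pd|nPd] := pselect (dom P (phi d)).
    by apply: leq_trans (domn _ Pd) _.
  by rewrite phi_new // => c' dc; apply: nPd; rewrite dc phi_old.
- exact: Ksub_push.
- have [f1I f1f f1r] := f1emb; split.
  + move=> x Tx; exists (gr (f' (exist _ x (mem_set Tx)))) => //.
    by rewrite -gE.
  + move=> x y Tx Ty; pose x' : B := exist _ x (mem_set Tx).
    pose y' : B := exist _ y (mem_set Ty).
    rewrite (gE x' : g x = _) (gE y' : g y = _) => /phi_inj /f1I.
    by case.
  + move=> s a aT; rewrite PQf; last by move=> k; exact: TP.
    have [a' ->] := tupB _ _ aT.
    have -> : g \o (val \o a') = phi \o ((gr \o f') \o a').
      by apply/funext => k /=; rewrite gE.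
    by rewrite QfE -f1f; exact: (gE (fint B s a')).
  + move=> r a aT; rewrite PQr; last by move=> k; exact: TP.
    have [a' ->] := tupB _ _ aT.
    have -> : g \o (val \o a') = phi \o ((gr \o f') \o a').
      by apply/funext => k /=; rewrite gE.
    by rewrite QrE -f1r.
- exact: gS.
- move=> x Tx Xx; pose b : B := exist _ x (mem_set Tx).
  have gx : g x = phi (gr (f' b)) by exact: (gE b).
  (* If [g x] is old, disjointness gives [x = e a] with [a] in [S]. Then [g x = a], and by the
     hypothesis on [p] the colour of [a] is already the prescribed one. *)
  have [Pgx|nPgx] := pselect (dom P (g x)); last first.
    by case: (cP' (g x)) => _ /(_ nPgx b gx) /= ->.
  have [c' /grI fc] : exists c', gr (f' b) = gr (g' c').
    by apply: oldE; rewrite -gx.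
  have [a _ fa] : range (f' \o f) (f' b).
    by rewrite -disj; split; [exists b|exists c'].
  have {}fa : f a = b by have [f'I _ _] := f'emb; exact: f'I.
  have xa : x = e (val a) by move/(congr1 val): fa.
  have Sa : S (val a) := set_mem (valP a).
  rewrite xa gS // colOld; last exact: (SP _ Sa).
  rewrite pS //; rewrite /Xat PQr in Xx; last by move=> _; exact: TP.
  by move: Xx; rewrite xa => Xx; apply/(e4 X (fun=> val a)).
- move=> u _; have [Pu|nPu] := pselect (dom P u); [by left|right].
  have [_ c2 c3] := cP' u.
  have [[x ux]|nx] := pselect (exists x : B, u = phi (gr (f' x))).
    by right; exists (val x); [exact: set_mem (valP x)|exact: c2].
  by left; apply: c3 => // x ux; apply: nx; exists x.
(* Growth gives [d] in [X] outside the image of the [X] of [D0]. As [gr] preserves and reflects [X],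
   [d] is outside the whole range of [gr], hence in neither copy. *)
- have [_ /existsNP[d /not_implyP[Xd nd]]] := grX.
  have ngr d0 : d <> gr d0.
    move=> dd; apply: nd; exists d0 => //.
    by apply/(embedding_pred X d0 gremb); rewrite -dd.
  exists (phi d); split; [by exists d|exact/XQ|].
  have [_ _ c3] := cP' (phi d); apply: c3 => [|x /phi_inj /ngr //].
  by apply: newNdom => c' /ngr.
Qed.

(** * Bookkeeping of the requests *)

(* For a history h, [(h n).2] is the map g_n and its domain is layer [(h n).1]. *)
Definition history : Type := nat -> nat * (point -> point).

(** The list [s] is a finite table of a map on colours. This map has to undo what [g_i] does to
    colours; otherwise no map inverting [g_i] could act on colours by [s]. *)
Definition partner (P : pstruct) (h : history) (i : nat) (s : seq nat) : Prop :=
  forall x, layer P (h i).1 x -> Xat P x ->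
    nth 0 s (col P ((h i).2 x)) = col P x.

(* The stage n itself codes the pair (i, s) treated there. *)
Definition served (P : pstruct) (h : history) (n : nat) : Prop :=
  if CodeSeq.decode n is i :: s then
    partner P h i s ->
    [/\ (h n).1 = i.+1,
        forall x, layer P (h i).1 x -> (h n).2 ((h i).2 x) = x
      & forall x, layer P i.+1 x -> Xat P x ->
          col P ((h n).2 x) = nth 0 s (col P x)]
  else (h n).1 = 0.

Definition node (P : pstruct) (h : history) (n : nat) : Prop :=
  [/\ (h n).1 <= n,
      pemb P (layer P (h n).1) (layer P n.+1) (h n).2,
      served P h n
    & exists x, [/\ layer P n.+1 x, Xat P x & col P x = n]].

(** The bound on colours is what lets a finite table describe the action of an arbitrary permutation
    on the layer. *)
Definition layer_ok (P : pstruct) (i : nat) : Prop :=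
  Ksub P (layer P i) /\ exists B, forall u, layer P i u -> col P u < B.

Definition stage_ok (n : nat) (P : pstruct) (h : history) : Prop :=
  [/\ dom P `<=` [set u | u.1 <= n],
      forall i, i <= n -> layer_ok P i,
      forall u, layer P 0 u -> ~ Xat P u
    & forall i, i < n -> node P h i].

Lemma extends_layer n P Q i : i <= n -> extends n P Q -> layer Q i = layer P i.
Proof.
move=> le_in [PQ _ _ _]; apply/seteqP; split=> u [du ui]; split=> //.
  by apply/PQ; split=> //; exact: leq_trans le_in.
by have /PQ[] := du.
Qed.

Lemma extends_Xat n P Q u : extends n P Q -> dom P u -> Xat Q u <-> Xat P u.
Proof. by move=> [_ _ er _] Pu; exact: er. Qed.

Lemma extends_layer_ok n P Q i : i <= n -> extends n P Q ->
  layer_ok P i -> layer_ok Q i.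
Proof.
move=> le_in PQ; rewrite /layer_ok (extends_layer le_in PQ).
have [_ ef er ec] := PQ => -[KP [B BP]]; split.
  apply: Ksub_agree KP => [s a aP|r a aP]; first by apply: ef => k; case: (aP k).
  by apply: er => k; case: (aP k).
by exists B => u Pu; rewrite ec; [exact: BP|case: Pu].
Qed.

(** The code of a list exceeds its entries, so [g_i] is already available at the stage that treats
    [(i, s)]. *)
Lemma decode_lt n i s : CodeSeq.decode n = i :: s -> i < n.
Proof.
move=> E; have /allP := CodeSeq.ltn_code (i :: s).
by move=> /(_ i); rewrite mem_head -E CodeSeq.decodeK; exact.
Qed.

(** A node at [i < n] concerns only points of layers up to [n], where [P] and [Q] agree. As
    [partner] is a premise inside [served], it is carried back from [Q] to [P]. *)
Lemma extends_node n P Q h h' : extends n P Q ->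
    (forall i, i < n -> h' i = h i) -> (forall i, i < n -> node P h i) ->
  forall i, i < n -> node Q h' i.
Proof.
move=> PQ hh' nodeP i ltin; have [i1 i2 i3 [x [Px Xx cx]]] := nodeP i ltin.
have [_ _ _ ec] := PQ.
have hn j : j <= n -> layer Q j = layer P j by move=> ?; exact: extends_layer PQ.
have le_n : (h i).1 <= n by apply: leq_trans i1 (ltnW ltin).
rewrite /node hh' // !hn //; split=> //.
- by apply: extends_pemb PQ i2 => u [].
- move: i3; rewrite /served; case E: CodeSeq.decode => [|j s]; rewrite hh' //.
  have ltji := decode_lt E.
  have ltjn : j < n := ltn_trans ltji ltin.
  have [j1 [j2 _ _ _] _ _] := nodeP j ltjn.
  have le_jn : (h j).1 <= n by apply: leq_trans j1 (ltnW ltjn).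
  move=> i3 pQ.
  have {i3}[|k1 k2 k3] := i3.
    move=> y Py Xy; have [Qy _] := Py; have [Qhy _] := j2 y Py.
    rewrite -(ec _ Qy) -(ec _ Qhy) -(hh' j ltjn); apply: pQ.
      by rewrite hh' // hn.
    exact/(extends_Xat PQ).
  split=> //.
    by move=> y; rewrite hh' // hn //; exact: k2.
  move=> y; rewrite hn // => Py Xy; have [Qy _] := Py.
  have [Qhy _] : layer P i.+1 ((h i).2 y).
    by case: i2 => + _ _ _; apply; rewrite k1.
  by rewrite !ec // k3 //; exact/(extends_Xat PQ).
- exists x; split=> //.
    by apply/(extends_Xat PQ) => //; case: Px.
  by rewrite ec //; case: Px.
Qed.

Lemma nth0_bounded (s : seq nat) : exists B, forall c, nth 0 s c < B.
Proof.
elim: s => [|x s [B IH]]; first by exists 1 => c; rewrite nth_nil.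
exists (maxn x.+1 B) => -[|c] /=; first by rewrite leq_max ltnS leqnn.
by rewrite leq_max IH orbT.
Qed.

Lemma request_at n P h : stage_ok n P h ->
  exists j k e s,
    [/\ j <= n, k <= n, pemb P (layer P j) (layer P k) e,
        forall x, layer P j x -> Xat P x -> nth 0 s (col P (e x)) = col P x
      & if CodeSeq.decode n is i :: s' then partner P h i s' ->
          [/\ j = (h i).1, k = i.+1, e = (h i).2 & s = s']
        else k = 0].
Proof.
move=> [_ _ X0 nodeP].
have dflt : exists j k e s,
    [/\ j <= n, k <= n, pemb P (layer P j) (layer P k) e,
        forall x, layer P j x -> Xat P x -> nth 0 s (col P (e x)) = col P x
      & k = 0].
  (* The default request, the identity of layer 0, serves when no valid pair is coded; its colour
     condition is vacuous because [X] is empty there. *)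
  exists 0, 0, id, [::]; split=> //.
  by move=> x /X0.
case E: CodeSeq.decode => [|i s] //.
have [pi|npi] := pselect (partner P h i s); last first.
  have [j [k [e [s' [? ? ? ? _]]]]] := dflt.
  by exists j, k, e, s'; split.
have ltin := decode_lt E; have [i1 i2 _ _] := nodeP i ltin.
exists (h i).1, i.+1, (h i).2, s; split=> //.
by apply: leq_trans i1 (ltnW ltin).
Qed.

Lemma stage_step n P h : stage_ok n P h ->
  exists Q h', [/\ stage_ok n.+1 Q h', extends n P Q
                 & forall i, i < n -> h' i = h i].
Proof.
move=> PK; have [j [k [e [s [lejn lekn eP es req]]]]] := request_at PK.
have [domn Kn X0 nodeP] := PK.
have Pn : layer P n = dom P.
  by apply/seteqP; split=> [u []|u du] //; split=> //; exact: domn.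
have [Kdom [B BP]] := Kn n (leqnn n); rewrite Pn in Kdom BP.
have [Kj _] := Kn j lejn; have [Kk _] := Kn k lekn.
have subP i : layer P i `<=` dom P by move=> u [].
have [Q [g [[PQ Qn KQ] [gE ge gs Qc Qx]]]] :=
  extension_step domn Kdom Kj Kk (@subP j) (@subP k) eP es.
have QnE : layer Q n.+1 = dom Q.
  by apply/seteqP; split=> [u []|u du] //; split=> //; exact: Qn.
have kQ := extends_layer lekn PQ.
pose h' i := if i == n then (k, g) else h i.
have hn : h' n = (k, g) by rewrite /h' eqxx.
have hlt i : i < n -> h' i = h i by rewrite /h'; case: ltngtP.
have [_ _ _ ec] := PQ.
exists Q, h'; split=> //; split=> //.
- move=> i; rewrite leq_eqVlt => /orP[/eqP ->|]; last first.
    by rewrite ltnS => lein; apply: extends_layer_ok PQ _ => //; exact: Kn.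
  split; rewrite QnE //; have [B' B'P] := nth0_bounded s.
  (* Old colours are below [B]; a new colour is either [n] or a value of the table [s]. *)
  exists (maxn B (maxn n.+1 B')) => u /Qc[Pu|[->|[x _ ->]]]; rewrite !leq_max.
  + by rewrite ec // BP.
  + by rewrite leqnn orbT.
  + by rewrite B'P !orbT.
- move=> u; rewrite (extends_layer (leq0n n) PQ) => Pu.
  by rewrite (extends_Xat PQ); [exact: X0|case: Pu].
- move=> m; rewrite ltnS leq_eqVlt => /orP[/eqP ->|]; last first.
    by move: m; exact: (extends_node PQ hlt nodeP).
  rewrite /node hn QnE kQ; split=> //.
  move: req; rewrite /served; case E: CodeSeq.decode => [|i s']; rewrite hn //.
  have ltin := decode_lt E; have [i1 [i2 _ _ _] _ _] := nodeP i ltin.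
  have leh : (h i).1 <= n by exact: leq_trans i1 (ltnW ltin).
  move=> req pQ; have {req}[|jE kE eE sE] := req.
    move=> y Py Xy; have [Qy _] := Py; have [Qhy _] := i2 y Py.
    rewrite -(ec _ Qy) -(ec _ Qhy) -(hlt i ltin); apply: pQ.
      by rewrite hlt // (extends_layer leh PQ).
    exact/(extends_Xat PQ).
  rewrite -{}sE hlt // (extends_layer leh PQ) -{}eE -{}jE -kE kQ.
  split=> // y Py Xy; rewrite gs // ec //; exact: subP Py.
Qed.

(** * The limit of the stages *)

Definition generic (P : pstruct) (h : history) : Prop :=
  [/\ forall i, layer_ok P i, forall u, layer P 0 u -> ~ Xat P u
    & forall i, node P h i].

Lemma extends_refl n P : dom P `<=` [set u | u.1 <= n] -> extends n P P.
Proof. by move=> Pn; split=> // u; split=> [Pu|[]] //; split=> //; exact: Pn. Qed.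

Lemma extends_trans n m P Q R : n <= m ->
  extends n P Q -> extends m Q R -> extends n P R.
Proof.
move=> lenm [d1 f1 r1 c1] [d2 f2 r2 c2].
have PQ u : dom P u -> dom Q u by move=> /d1[].
split=> [u|s a aP|r a aP|u Pu].
- split=> [/d1[/d2[Ru _] un]|[Ru un]]; first by [].
  by apply/d1; split=> //; apply/d2; split=> //; exact: leq_trans lenm.
- by rewrite f2 ?f1 // => k; exact: PQ.
- by rewrite r2 ?r1 // => k; exact: PQ.
- by rewrite c2 ?c1 //; exact: PQ.
Qed.

Section Limit.
Variable P : nat -> pstruct.
Hypothesis Pdom : forall n, dom (P n) `<=` [set u | u.1 <= n].
Hypothesis Pext : forall n, extends n (P n) (P n.+1).

Lemma chain_extends n m : n <= m -> extends n (P n) (P m).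
Proof.
move=> /subnK <-; elim: (m - n) => [|d IH]; first exact: extends_refl.
by apply: extends_trans IH (Pext _); exact: leq_addl.
Qed.

(** For arguments in the domain, the maximum of the first components is the first stage containing
    them all; later stages agree with it. *)
Definition limit : pstruct := Pstruct
  [set u | dom (P u.1) u]
  (fun s a => fn (P (\max_i (a i).1)) a)
  (fun r a => rl (P (\max_i (a i).1)) a)
  (fun u => col (P u.1) u).

Lemma chain_dom n m u : u.1 <= m -> m <= n -> dom (P n) u -> dom (P m) u.
Proof. by move=> um mn Pu; have [d _ _ _] := chain_extends mn; exact/d. Qed.

Lemma limit_extends n : extends n (P n) limit.
Proof.
have maxP k (a : 'I_k -> point) : (forall i, dom (P n) (a i)) ->
    \max_i (a i).1 <= n /\ forall i, dom (P (\max_i (a i).1)) (a i).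
  move=> aP; have len : \max_i (a i).1 <= n.
    by apply/bigmax_leqP => i _; exact: (Pdom (aP i)).
  by split=> // i; apply: chain_dom (aP i) => //; exact: leq_bigmax.
split=> [u|s a /maxP[len aP]|r a /maxP[len aP]|u Pu] /=.
- split=> [Pu|[/= Pu un]]; last by have [d _ _ _] := chain_extends un; case/d: Pu.
  have un := Pdom Pu; split=> //=; exact: chain_dom Pu.
- by have [_ -> ] := chain_extends len.
- by have [_ _ ->] := chain_extends len.
- have un := Pdom Pu; have [_ _ _ ->] := chain_extends un => //.
  exact: chain_dom Pu.
Qed.

End Limit.

Lemma initial_stage : (exists2 A, K A & pred_of X A = set0) ->
  exists P h, stage_ok 0 P h.
Proof.
move=> [A KA XA]; have [nu nuI] := countable_inj KA.
pose phi (a : A) : point := (0, nu a).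
have phi_inj : injective phi by move=> x y [/nuI].
pose P := push phi (fun=> 0).
have P0 : layer P 0 = dom P.
  by apply/seteqP; split=> [u []|_ [a _ <-]] //; split=> //; exists a.
exists P, (fun=> (0, id)); split=> //.
- by move=> _ [a _ <-].
- move=> i; rewrite leqn0 => /eqP ->; split; last by exists 1.
  by rewrite P0; exact: Ksub_push.
- rewrite P0 => _ [a _ <-] /(push_rlE phi_inj (r := X) (fun=> a)) Xa.
  by have : pred_of X A a by []; rewrite XA.
Qed.

Lemma generic_exists : (exists2 A, K A & pred_of X A = set0) ->
  exists P h, generic P h.
Proof.
move=> /initial_stage[P0 [h0 ok0]].
(* The requirement is conditional on [stage_ok], so that choice applies to all pairs; the premise
   then holds along the sequence by induction. *)
pose R n (x y : pstruct * history) := stage_ok n x.1 x.2 ->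
  [/\ stage_ok n.+1 y.1 y.2, extends n x.1 y.1
    & forall i, i < n -> y.2 i = x.2 i].
have /choice[F FP] : forall nx : nat * (pstruct * history), exists y, R nx.1 nx.2 y.
  move=> [n [P h]]; have [/stage_step|nok] := pselect (stage_ok n P h).
    by move=> [Q [h' QP]]; exists (Q, h').
  by exists (P, h) => /nok.
pose st := fix st n := if n is m.+1 then F (m, st m) else (P0, h0).
have stP n : stage_ok n (st n).1 (st n).2.
  by elim: n => //= n IH; case: (FP (n, st n) IH).
have stE n : extends n (st n).1 (st n.+1).1.
  by case: (FP (n, st n) (stP n)).
have stH n i : i < n -> (st n.+1).2 i = (st n).2 i.
  by case: (FP (n, st n) (stP n)) => _ _; exact.
(* The map [g_i] is made in passing from stage [i] to stage [i.+1] and never changes afterwards. *)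
pose h i := (st i.+1).2 i.
have hE n i : i < n -> h i = (st n).2 i.
  move=> /subnK <-; elim: (n - i.+1) => // d IH.
  by rewrite addSn stH // -?IH // leq_addl.
pose P n := (st n).1.
have Pdom n : dom (P n) `<=` [set u | u.1 <= n] by case: (stP n).
have limE := limit_extends Pdom stE.
exists (limit P), h; split.
- move=> i; apply: (extends_layer_ok (leqnn i) (limE i)).
  by have [_ + _ _] := stP i; exact.
- move=> u; rewrite (extends_layer (leqnn 0) (limE 0)) => Pu.
  rewrite (extends_Xat (limE 0)); last by case: Pu.
  by have [_ _ + _] := stP 0; exact.
- move=> i; have [_ _ _ nodeP] := stP i.+1.
  exact: (extends_node (limE i.+1) (hE i.+1) nodeP (ltnSn i)).
Qed.
(** The finitely many arguments lie in a single layer, which is closed. *)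
Lemma generic_closed P h : generic P h -> @closed_subset L (str P) (dom P).
Proof.
move=> [ok _ _] s a aP; have [[cS _] _] := ok (\max_i (a i).1).
by case: (cS s a) => // i; split; [exact: aP|exact: leq_bigmax].
Qed.

(** * Back and forth along a permutation of the colours *)

Section BackAndForth.
Variables (P : pstruct) (h : history) (gen : generic P h).
Variables (phi psi : nat -> nat).
Hypotheses (phiK : cancel phi psi) (psiK : cancel psi phi).

Let turn (b : bool) : nat -> nat := if b then psi else phi.

Let turnK b : cancel (turn b) (turn (~~ b)).
Proof. by case: b. Qed.

Definition follows (b : bool) (i : nat) : Prop :=
  forall x, layer P (h i).1 x -> Xat P x -> col P ((h i).2 x) = turn b (col P x).

(** Take for [i'] the code of [i] followed by the table of [turn (~~ b)] below [B]. The bound [B]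
    covers the colours of layer [i.+1], which contains the image of [g_i] and is the domain of the
    new map, so the table loses nothing. *)
Lemma follows_next b i : follows b i ->
  exists i', [/\ i < i', follows (~~ b) i', (h i').1 = i.+1
    & forall x, layer P (h i).1 x -> (h i').2 ((h i).2 x) = x].
Proof.
move=> fi; have [ok _ nodeP] := gen.
have [_ [B BP]] := ok i.+1; have [_ [i2 _ _ i4] _ _] := nodeP i.
pose s := mkseq (turn (~~ b)) B; pose i' := CodeSeq.code (i :: s).
have E : CodeSeq.decode i' = i :: s by exact: CodeSeq.codeK.
have sE x : layer P i.+1 x -> nth 0 s (col P x) = turn (~~ b) (col P x).
  by move=> /BP lt_xB; rewrite nth_mkseq.
have [_ _ + _] := nodeP i'; rewrite /served E => -[|lvl hK hs].
  by move=> x Px Xx; rewrite sE ?fi ?turnK //; exact: i2.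
exists i'; split=> //; first exact: decode_lt E.
by move=> x; rewrite lvl => Px Xx; rewrite hs // sE.
Qed.

(** Iterate [follows_next] from [g_0]. Its domain is layer 0, without elements of [X], so it follows
    any permutation. The indices increase strictly, whence [D t] contains layer [t]. *)
Lemma zigzag : exists g : nat -> point -> point, exists D : nat -> set point,
  [/\ forall t, layer P t `<=` D t,
      forall t, pemb P (D t) (D t.+1) (g t),
      forall t, D t `<=` dom P,
      forall t x, D t x -> g t.+1 (g t x) = x
    & forall t x, D t x -> Xat P x -> col P (g t x) = turn (odd t) (col P x)].
Proof.
have [_ X0 nodeP] := gen.
have /choice[F FP] : forall bi : bool * nat, exists i', follows bi.1 bi.2 ->
    [/\ bi.2 < i', follows (~~ bi.1) i', (h i').1 = bi.2.+1
      & forall x, layer P (h bi.2).1 x -> (h i').2 ((h bi.2).2 x) = x].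
  move=> [b i]; have [/follows_next[i' iP]|nf] := pselect (follows b i).
    by exists i'.
  by exists 0 => /nf.
pose idx := fix idx t := if t is t'.+1 then F (odd t', idx t') else 0.
(* The list coded by 0 is empty, so stage 0 has no request. *)
have lvl0 : (h 0).1 = 0 by have [_ _ + _] := nodeP 0.
have fol t : follows (odd t) (idx t).
  elim: t => [|t IH]; last by case: (FP (odd t, idx t) IH).
  by move=> x; rewrite lvl0 => /X0.
have step t : [/\ idx t < idx t.+1, (h (idx t.+1)).1 = (idx t).+1
    & forall x, layer P (h (idx t)).1 x ->
        (h (idx t.+1)).2 ((h (idx t)).2 x) = x].
  by case: (FP (odd t, idx t) (fol t)).
have le_idx t : t <= idx t.
  by elim: t => // t IH; have [lt_idx _ _] := step t; exact: leq_ltn_trans lt_idx.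
exists (fun t => (h (idx t)).2), (fun t => layer P (h (idx t)).1); split.
- move=> [|t]; first by rewrite lvl0.
  by have [_ -> _] := step t; apply: layerS; rewrite ltnS.
- by move=> t; have [_ -> _] := step t; case: (nodeP (idx t)).
- by move=> t u [].
- by move=> t x; have [_ _] := step t; exact.
- by move=> t x; exact: fol.
Qed.

(** As [g t.+1] inverts [g t] and [g t.+2] inverts [g t.+1], the map [g t.+2] extends [g t]. The
    even maps follow [phi] and have union [sigma]; the odd ones have union [tau]. *)
Lemma back_and_forth : exists sigma tau : point -> point,
  [/\ pemb P (dom P) (dom P) sigma,
      forall x, dom P x -> dom P (tau x),
      forall x, dom P x -> sigma (tau x) = x
    & forall x, dom P x -> Xat P x -> col P (sigma x) = phi (col P x)].
Proof.
have [g [D [layD gP Ddom gK gc]]] := zigzag.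
have gD t x : D t x -> D t.+1 (g t x) by case: (gP t) => + _ _ _; exact.
have g2 t x : D t x -> g t.+2 x = g t x.
  by move=> Dx; rewrite -{1}(gK t x Dx) gK //; exact: gD.
have D2 t x : D t x -> D t.+2 x.
  by move=> Dx; rewrite -(gK t x Dx); exact/gD/gD.
have later t k x : D t x -> g (k.*2 + t) x = g t x /\ D (k.*2 + t) x.
  move=> Dx; elim: k => // k [IH1 IH2].
  by rewrite doubleS !addSn g2 //; split=> //; exact: D2.
have dD m x : dom P x -> x.1 <= m -> D m x by move=> Px xm; apply: layD.
(* These indices have the right parity and are at least [x.1], so [x] is in the domain; larger
   indices of the same parity give the same value. *)
pose sigma x := g x.1.*2 x; pose tau x := g x.1.*2.+1 x.
have x2 (x : point) : x.1 <= x.1.*2 by rewrite -addnn leq_addr.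
have sE m x : dom P x -> x.1 <= m -> sigma x = g m.*2 x.
  move=> Px /subnK <-; rewrite doubleD.
  by have [->] := later x.1.*2 (m - x.1) x (dD _ _ Px (x2 x)).
have tE m x : dom P x -> x.1 <= m -> tau x = g m.*2.+1 x.
  move=> Px /subnK <-; rewrite doubleD -addnS.
  by have [->] := later x.1.*2.+1 (m - x.1) x (dD _ _ Px (leqW (x2 x))).
have dm x m : dom P x -> x.1 <= m -> D m.*2 x.
  by move=> Px xm; apply: dD => //; apply: leq_trans xm _; rewrite -addnn leq_addr.
have sdom x : dom P x -> dom P (sigma x).
  by move=> Px; apply: (Ddom x.1.*2.+1); apply: gD; exact: dm.
have tdom x : dom P x -> dom P (tau x).
  by move=> Px; apply: (Ddom x.1.*2.+2); apply: gD; apply: dD => //; exact: leqW.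
have tups k (a : 'I_k -> point) : (forall i, dom P (a i)) ->
    exists m, forall i, (a i).1 <= m.
  by move=> aP; exists (\max_i (a i).1) => i; exact: leq_bigmax.
exists sigma, tau; split=> //.
- split=> //.
  + move=> x y Px Py; pose m := maxn x.1 y.1.
    rewrite (sE m x Px) ?leq_maxl // (sE m y Py) ?leq_maxr //.
    by case: (gP m.*2) => _ + _ _; apply; apply: dm; rewrite ?leq_maxl ?leq_maxr.
  (* Here [m] also bounds the stage of the value, so the single map [g m.*2] computes [sigma] at the
     arguments and at the value. *)
  + move=> s a aP; have [m0 m0P] := tups _ a aP; pose m := maxn m0 (fn P a).1.
    have mP i : (a i).1 <= m by apply: leq_trans (m0P i) (leq_maxl _ _).
    have -> : sigma \o a = g m.*2 \o a by apply/funext => i; exact: sE.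
    rewrite (sE m) ?leq_maxr //; last exact: (generic_closed gen).
    by case: (gP m.*2) => _ _ + _; apply=> i; exact: dm.
  + move=> r a aP; have [m mP] := tups _ a aP.
    have -> : sigma \o a = g m.*2 \o a by apply/funext => i; exact: sE.
    by case: (gP m.*2) => _ _ _; apply=> i; exact: dm.
(* Evaluating [sigma] at [m.+1] uses the map of index [m.*2.+2], which inverts the map of index
   [m.*2.+1] computing [tau x]. *)
- move=> x Px; pose m := maxn x.1 (tau x).1.
  rewrite (sE m.+1 _ (tdom x Px)); last by rewrite leqW // leq_maxr.
  rewrite (tE m x Px) ?leq_maxl // doubleS gK //.
  by apply: dD => //; rewrite leqW // -addnn (leq_trans _ (leq_addr _ _)) ?leq_maxl.
- move=> x Px Xx; rewrite (sE x.1) // gc //; last exact: dm.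
  by rewrite odd_double.
Qed.

End BackAndForth.
End Class.
End Construction.

(** * The quotient by equality of colours *)

Section Quotient.
Variables (T : Type) (c : T -> nat).
Hypothesis c_surj : forall n, exists x, c x = n.

Definition fiber_rel : T -> set T := fun x => [set y | c y = c x].

Lemma fiber_rel_equiv : Equivalence fiber_rel.
Proof. by split=> [x|x y|x y z] //=; rewrite /fiber_rel /= => -> // ->. Qed.

Lemma fiber_relE x y : fiber_rel x = fiber_rel y <-> c x = c y.
Proof.
split=> [E|E]; last by rewrite /fiber_rel E.
by have : fiber_rel x x by []; rewrite E.
Qed.

Lemma class_of_fiberE x y :
  class_of fiber_rel x = class_of fiber_rel y <-> c x = c y.
Proof.
rewrite -fiber_relE; split=> [/(congr1 val)//|E]; exact: val_inj.
Qed.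

(** Sending a class to its colour maps the set of classes onto the natural numbers. *)
Lemma infinite_fibers : infinite_set (range fiber_rel).
Proof.
have [r rP] := choice c_surj.
have /choice[f fP] : forall S : set T, exists n, forall x, S = fiber_rel x -> n = c x.
  move=> S; have [[x ->]|nS] := pselect (exists x, S = fiber_rel x).
    by exists (c x) => y /fiber_relE.
  by exists 0 => x Sx; case: nS; exists x.
move=> /(finite_image f) fin; apply: infinite_nat.
apply: sub_finite_set fin => n _.
exists (fiber_rel (r n)); first by exists (r n).
by rewrite (fP _ (r n)).
Qed.

(** Colours correspond bijectively to classes through [cl]; conjugating [h] and its inverse by [cl]
    gives [phi] and [psi]. *)
Lemma quotient_permutation (h : quotient fiber_rel -> quotient fiber_rel) :
  bijective h -> exists phi psi : nat -> nat,
    [/\ cancel phi psi, cancel psi phi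
      & forall x y, c y = phi (c x) ->
          class_of fiber_rel y = h (class_of fiber_rel x)].
Proof.
move=> [h' hK h'K]; have [r rP] := choice c_surj.
pose cl n := class_of fiber_rel (r n).
have clE x : class_of fiber_rel x = cl (c x).
  by apply/class_of_fiberE; rewrite rP.
have cl_inj : injective cl by move=> m n /class_of_fiberE; rewrite !rP.
have /choice[num numP] : forall q : quotient fiber_rel, exists n, cl n = q.
  move=> [S S_in]; have /set_mem[x _ xS] := S_in.
  by exists (c x); rewrite -clE; exact: val_inj.
exists (fun n => num (h (cl n))), (fun n => num (h' (cl n))); split.
- by move=> n; apply: cl_inj; rewrite !numP hK.
- by move=> n; apply: cl_inj; rewrite !numP h'K.
- by move=> x y E; rewrite !clE E numP.
Qed.

End Quotient.

(** * Automorphisms of the limit and conclusion *)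

Lemma permutation_automorphism (L : language) (P : pstruct L)
    (cP : @closed_subset L (str P) (dom P)) (sigma tau : point -> point)
    (sP : pemb P (dom P) (dom P) sigma) :
    (forall x, dom P x -> dom P (tau x)) ->
    (forall x, dom P x -> sigma (tau x) = x) ->
  exists2 f : substructure cP -> substructure cP, automorphism f &
    forall x, val (f x) = sigma (val x).
Proof.
move=> tdom sK; have [s1 s2 s3 s4] := sP.
have vdom (x : substructure cP) : dom P (val x) := set_mem (valP x).
exists (fun x => exist _ (sigma (val x)) (mem_set (s1 _ (vdom x)))) => //.
split; last first.
  apply: inj_surj_bijective => [x y [/s2 E]|x].
    by apply: val_inj; apply: E; exact: vdom.
  exists (exist _ (tau (val x)) (mem_set (tdom _ (vdom x)))).
  by apply: val_inj; exact: (sK _ (vdom x)).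
split=> [x y [/s2 E]|s a|r a]; first by apply: val_inj; apply: E; exact: vdom.
- by apply: val_inj; rewrite /= s3 // => k; exact: vdom.
- by rewrite /= s4 // => k; exact: vdom.
Qed.

Theorem theoremA2 (L : language) (X : rsym L) (K : structure L -> Prop)
    (cL : countable_language L) (unaryX : rarity X = 1)
    (cK : forall A : structure L, K A -> countable [set: A])
    (sK : suitable X K) :
  exists2 M : structure L, is_limit K M &
  exists E : pred_of X M -> set (pred_of X M),
    [/\ Equivalence E,
        infinite_set (range E)
      & forall h : quotient E -> quotient E, bijective h ->
        exists2 sigma : M -> M, automorphism sigma &
          forall x : pred_of X M,
          exists2 y : pred_of X M,
            val y = sigma (val x) & class_of E y = h (class_of E x)].
Proof.
have [isoK daK grK empK] := sK.
have [P [h gen]] := generic_exists isoK cK daK grK empK.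
have cP := generic_closed gen; have [ok _ nodeP] := gen.
pose M := substructure cP; exists M.
  pose A n : set M := [set u | layer P n (val u)].
  have cA n : closed_subset (A n).
    by have [[cS _] _] := ok n; move=> s a aP; exact: cS.
  exists A, cA; split.
  - move=> n; have [[cS KS] _] := ok n.
    have lay (u : substructure cS) : layer P n (val u) := set_mem (valP u).
    have dlay (u : substructure cS) : dom P (val u) by case: (lay u).
    pose f (u : substructure cS) : substructure (cA n) :=
      exist _ (exist _ (val u) (mem_set (dlay u)) : M) (mem_set (lay u)).
    apply: (isoK _ _ f) => //; split; last first.
      apply: inj_surj_bijective => [x y [/val_inj //]|u].
      exists (exist _ (val (val u)) (mem_set (set_mem (valP u)))).
      by apply: val_inj; exact: val_inj.
    by split=> [x y [/val_inj //]|s a|r a] //; apply: val_inj; exact: val_inj.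
  - by move=> n m le_nm u; exact: layerS.
  - rewrite -subTset => u _; exists (val u).1 => //.
    by split=> //; exact: set_mem (valP u).
pose c (x : pred_of X M) : nat := col P (val (val x)).
have Xdom (x : pred_of X M) : dom P (val (val x)) := set_mem (valP (val x)).
have Xx (x : pred_of X M) : Xat X P (val (val x)) := set_mem (valP x).
have c_surj n : exists x, c x = n.
  (* Stage [n] created a point of [X] of colour [n]. *)
  have [_ _ _ [u [[Pu _] Xu cu]]] := nodeP n.
  by exists (exist _ (exist _ u (mem_set Pu) : M) (mem_set Xu)).
exists (fiber_rel c); split; first exact: fiber_rel_equiv.
  exact: infinite_fibers.
move=> H /(quotient_permutation c_surj)[phi [psi [phiK psiK HE]]].
have [sigma [tau [sP tdom sK' sc]]] := back_and_forth gen phiK psiK.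
have [f f_aut fE] := permutation_automorphism cP sP tdom sK'.
exists f => // x.
have Xfx : pred_of X M (f (val x)).
  by case: f_aut => femb _; apply/embedding_pred => //; exact: set_mem (valP x).
exists (exist _ (f (val x)) (mem_set Xfx)) => //.
by apply: HE; rewrite /c /= fE sc; [|exact: Xdom|exact: Xx].
Qed.
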